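(* Total expectation theorem for an MC: Under the conservation of distribution condition, i.e. $\pi_k\propto\pi^j_k$ for all $k\in A_j$ and all $j\in J$ (for each $j\in J$ the vectors $(\pi_k)_{k\in A_j}$ and $(\pi^j_k)_{k\in A_j}$ are proportional), an expectation of the full MC can be represented by expectations and steady-state probabilities of subchains: for any function $f(X)$ of the state, and with the reference state $k$ being any state of the full MC ($k\in S$), $$\frac{E[f(X)]}{\pi_k}=\sum_{j\in J^+}\frac{E_j[f(X)]}{\pi^j_{(k)}}-\sum_{j\in J^-}\frac{E_j[f(X)]}{\pi^j_{(k)}}.$$
   Context: Consider an ergodic (irreducible, positive recurrent) continuous-time Markov chain (the full MC) on a countable state space $S$, with stationary distribution $(\pi_k)_{k\in S}$ (so $\pi_k>0$ for all $k$). $X$ denotes the state, and $E[f(X)]=\sum_{k\in S}f(k)\pi_k$ is the stationary expectation on the full MC. The full MC is decomposed into subchains. Let $J^+$ be a nonempty index set, $J^-$ a (possibly empty) index set, and $J=J^+\cup J^-$. For each $j\in J$ let $A_j\subseteq S$ be the nonempty set of states that compose subchain $j$, with $S=\bigcup_{j\in J^+}A_j$ (the sets need not be disjoint) and $$\sum_{j\in J^+}I(k\in A_j)-\sum_{j\in J^-}I(k\in A_j)=1\quad\text{for all }k\in S,$$ where $I(\cdot)$ is the indicator function. For each $j\in J$, subchain $j$ is an ergodic Markov chain with state space $A_j$ and stationary distribution $(\pi^j_k)_{k\in A_j}$, and $E_j[f(X)]=\sum_{k\in A_j}f(k)\pi^j_k$ is the expectation evaluated on subchain $j$. Under conservation of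 distribution, for $j\in J$ and $k\in S$ (not necessarily in $A_j$) define $\pi^j_{(k)}=\frac{\pi_k}{\pi_{k'}}\,\pi^j_{k'}$ with any $k'\in A_j$; this does not depend on the choice of $k'\in A_j$, and $\pi^j_{(k)}=\pi^j_k$ if $k\in A_j$.
   Formalization: Instead of any f, f must be such that the signed double sum over subchains and their states is not ∞−∞ (positive or negative terms have finite total); for finite J this says only that the formula is defined, and for infinite J the identity can otherwise fail. *)

(* Defs.v *)
From HB Require Import structures.
From mathcomp Require Import all_boot all_order all_algebra.
From mathcomp Require Import all_classical all_reals all_analysis.

Set Implicit Arguments.
Unset Strict Implicit.
Unset Printing Implicit Defensive.

Import Order.TTheory GRing.Theory Num.Theory.
Import numFieldNormedType.Exports.

Local Open Scope classical_set_scope.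
Local Open Scope ring_scope.

(* A time-homogeneous continuous-time Markov chain with state space [A]: a
   right-continuous process (for the discrete topology on [A]) together with
   its law for each initial state.  [ctmc_state t] and [ctmc_law i] are
   meaningful only for [0 <= t] and [A i]. *)
Record ctmc (R : realType) (S : countType) (A : set S) := Ctmc {
  ctmc_disp : measure_display;
  ctmc_space : measurableType ctmc_disp;
  ctmc_law : S -> probability ctmc_space R;
  ctmc_state : R -> ctmc_space -> S;
  ctmc_in : forall t w, 0 <= t -> A (ctmc_state t w);
  ctmc_measurable : forall t k, 0 <= t ->
    measurable (ctmc_state t @^-1` [set k]);
  ctmc_rcont : forall w t, 0 <= t ->
    \forall u \near t^'+, ctmc_state u w = ctmc_state t w;
  ctmc_init : forall i, A i -> ctmc_law i (ctmc_state 0 @^-1` [set i]) = 1%E;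
  (* Markov property w.r.t. the natural filtration:
     P_i(C, X_s = k, X_(s+h) = l) = P_i(C, X_s = k) P_k(X_h = l). *)
  ctmc_markov : forall i k l s h (C : set ctmc_space),
    A i -> A k -> 0 <= s -> 0 <= h ->
    <<s [set B | exists u m, 0 <= u <= s /\
                             B = ctmc_state u @^-1` [set m]] >> C ->
    ctmc_law i (C `&` (ctmc_state s @^-1` [set k])
                  `&` (ctmc_state (s + h) @^-1` [set l])) =
    (ctmc_law i (C `&` (ctmc_state s @^-1` [set k])) *
     ctmc_law k (ctmc_state h @^-1` [set l]))%E
}.

Arguments ctmc_disp {R S A} c : rename.
Arguments ctmc_space {R S A} c : rename.
Arguments ctmc_law {R S A} c i : rename.
Arguments ctmc_state {R S A} c t w : rename.

Section chain.
Context (R : realType) (S : countType) (A : set S) (X : ctmc R A).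

Definition trans (t : R) (i l : S) : \bar R :=
  ctmc_law X i (ctmc_state X t @^-1` [set l]).

Definition irreducible : Prop :=
  forall i l, A i -> A l -> exists2 t, 0 <= t & (0 < trans t i l)%E.

Definition first_jump (w : ctmc_space X) : \bar R :=
  ereal_inf [set t%:E | t in [set t | 0 <= t /\
                                      ctmc_state X t w <> ctmc_state X 0 w]].

Definition return_time (i : S) (w : ctmc_space X) : \bar R :=
  ereal_inf [set t%:E | t in [set t | (first_jump w <= t%:E)%E /\
                                      ctmc_state X t w = i]].

Definition absorbing (i : S) : Prop := forall t, 0 <= t -> trans t i i = 1%E.

(* An absorbing state counts as positive recurrent although its return time is
   infinite; this matters for one-state chains. *)
Definition positive_recurrent_state (i : S) : Prop :=
  absorbing i \/ (\int[ctmc_law X i]_w return_time i w < +oo)%E.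

Definition positive_recurrent : Prop :=
  forall i, A i -> positive_recurrent_state i.

Definition ergodic : Prop := irreducible /\ positive_recurrent.

Definition stationary (pi : S -> R) : Prop :=
  [/\ forall k, A k -> 0 <= pi k,
      (\esum_(k in A) (pi k)%:E = 1)%E &
      forall t l, 0 <= t -> A l ->
        (\esum_(k in A) ((pi k)%:E * trans t k l) = (pi l)%:E)%E].

End chain.

(* Unconditional sum of a family of arbitrary sign ([\esum] is only meaningful
   for nonnegative families). *)
Definition signed_esum (R : realType) (I : choiceType) (D : set I)
    (a : I -> \bar R) : \bar R :=
  (\esum_(i in D) a^\+ i - \esum_(i in D) a^\- i)%E.

Definition expect (R : realType) (S : countType) (A : set S) (pi f : S -> R) :
  \bar R := signed_esum A (fun k => (f k * pi k)%:E).

Definition conservation (R : realType) (S : countType) (J : choiceType)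
    (A : J -> set S) (pi : S -> R) (pij : J -> S -> R) : Prop :=
  forall j, exists c : R, forall k, A j k -> pi k = c * pij j k.

(* pi^j_(k), computed from the state k' of subchain j. *)
Definition ext_prob (R : realType) (S : Type) (pi pij : S -> R) (k' k : S) : R :=
  pi k / pi k' * pij k'.

(* The signed double series
     sum_(j in Jp) sum_(k in A j) f k pij j k / p j
       - sum_(j in Jm) sum_(k in A j) f k pij j k / p j
   is not of the form oo - oo: its positive or its negative terms have a finite
   sum. *)
Definition sums_well_defined (R : realType) (S : countType) (J : choiceType)
    (Jp Jm : set J) (A : J -> set S) (pij : J -> S -> R) (p : J -> R)
    (f : S -> R) : Prop :=
  (\esum_(j in Jp) (expect (A j) (pij j) (f^\+)%R / (p j)%:E) +
   \esum_(j in Jm) (expect (A j) (pij j) (f^\-)%R / (p j)%:E) < +oo)%E \/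
  (\esum_(j in Jp) (expect (A j) (pij j) (f^\-)%R / (p j)%:E) +
   \esum_(j in Jm) (expect (A j) (pij j) (f^\+)%R / (p j)%:E) < +oo)%E.

(* Main.v *)
Require Import Defs.
From HB Require Import structures.
From mathcomp Require Import all_boot all_order all_algebra.
From mathcomp Require Import all_classical all_reals all_analysis.
From mathcomp Require Import lra.

(** Put w_l = pi_l / pi_k.  Irreducibility makes stationary distributions
    positive ([stationary_gt0]), so on subchain j conservation reads
    pi = c * pij j with c > 0, and pi^j_(k) = pi_k / c.  Hence
      E_j[g] / pi^j_(k) = sum of g l * w_l over l in A_j
    ([expect_div_ext_prob]): the constant c disappears, and every term of the
    identity becomes a sum of one and the same weighted function over a part
    of the state space.

    For g >= 0, exchanging the sums over j and l turns
    sum_(j in Jp) E_j[g] / pi^j_(k) into the sum over l of g l * w_l times the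
    number of positive subchains containing l.  This number is one more than
    the number of negative ones, so
      sum_(j in Jp) E_j[g] / pi^j_(k) =
        E[g] / pi_k + sum_(j in Jm) E_j[g] / pi^j_(k),
    an identity in [0, +oo] without subtraction ([esum_signed_cover]).

    For f of arbitrary sign this is applied to f^+ and f^-, and the two
    identities are subtracted.  What remains is to avoid oo - oo: the
    well-definedness hypothesis makes the positive or the negative
    contributions have a finite total.  This is what allows a sum of differences to be
    split into a difference of sums ([signed_esumB]) and the contributions of
    the negative subchains to be cancelled ([sube_common_cancel]). *)

Set Implicit Arguments.
Unset Strict Implicit.
Unset Printing Implicit Defensive.

Import Order.TTheory GRing.Theory Num.Theory.
Import numFieldNormedType.Exports.

Local Open Scope classical_set_scope.
Local Open Scope ring_scope.

Section unconditional_sums.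
Context {R : realType}.
Local Open Scope ereal_scope.

Lemma ge0_esumZl (I : choiceType) (D : set I) (c : R) (a : I -> \bar R) :
  (0 <= c)%R -> (forall i, D i -> 0 <= a i) ->
  \esum_(i in D) (c%:E * a i) = c%:E * \esum_(i in D) a i.
Proof.
move=> c0 a0; rewrite /esum -ereal_supZl//; last first.
  by apply/set0P; exists (\sum_(i \in set0) a i), set0 => //; exact: fsets_set0.
rewrite image_comp; congr ereal_sup; apply: eq_imagel => F [finF FD] /=.
rewrite !fsbig_finite// [in RHS]big_seq ge0_sume_distrr -?big_seq//.
by move=> i; rewrite in_fset_set// inE => /FD/a0.
Qed.

(** Tonelli for a nonnegative function on overlapping blocks: each [g k] is
    counted as many times as there are blocks containing [k]. *)
Lemma esum_exchange_cover (I K : choiceType) (D : set I) (A : I -> set K)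
    (g : K -> R) :
  (forall k, (0 <= g k)%R) ->
  \esum_(i in D) \esum_(k in A i) (g k)%:E =
  \esum_(k in [set: K]) ((g k)%:E * \esum_(i in D) (\1_(A i) k)%:E).
Proof.
move=> g0.
have gA0 i k : 0 <= (g k)%:E * (\1_(A i) k)%:E by rewrite mule_ge0 ?lee_fin.
under [RHS]eq_esum => k _ do rewrite -ge0_esumZl//.
transitivity (\esum_(i in D) \esum_(k in [set: K])
                ((g k)%:E * (\1_(A i) k)%:E)).
  apply: eq_esum => i _; rewrite esum_mkcond; apply: eq_esum => k _.
  by rewrite indicE; case: (k \in A i); rewrite ?mule1 ?mule0.
rewrite !esum_esum//.
rewrite (@reindex_esum _ _ _ ([set: K] `*`` (fun=> D)) _
                       (fun z => (z.2, z.1)))//.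
split=> [[k i] [] //|[k i] [k' i'] _ _ [-> ->] //|[i k] [Di _]].
by exists (k, i).
Qed.

(** The positive part p and the negative part n of x - y satisfy p + y = x + n.
    Unlike p - n = x - y, this form is preserved by summation in [0, +oo]. *)
Lemma maxe_sub_balance (x y : \bar R) :
  0 <= x -> 0 <= y -> x < +oo \/ y < +oo ->
  [/\ maxe (x - y) 0 <= x, maxe (- (x - y)) 0 <= y &
      maxe (x - y) 0 + y = x + maxe (- (x - y)) 0].
Proof.
case: x y => [x| |] [y| |] //; rewrite ?lee_fin => x0 y0 fin.
- rewrite -EFinB -EFinN -!EFin_max -!EFinD !lee_fin !ge_max x0 y0 !andbT.
  rewrite opprB !lerBlDr !lerDl x0 y0; split=> //; congr EFin.
  by rewrite /Order.max; case: ifP; case: ifP; lra.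
- by rewrite /= /maxe ltNyr ltNge !leey/= lee_fin.
- by rewrite /= /maxe ltNyr ltNge !leey/= lee_fin.
- by case: fin.
Qed.

(** Undoes the rearrangement of [maxe_sub_balance] after summation; the bounds
    by [P] and [N] transfer finiteness to [p] and [n]. *)
Lemma sube_eq_balance (p n P N : \bar R) :
  0 <= p <= P -> 0 <= n <= N -> P < +oo \/ N < +oo ->
  p + N = P + n -> p - n = P - N.
Proof.
case: p n P N => [p| |] [n| |] [P| |] [N| |] // /andP[_ pP] /andP[_ nN] [] //.
all: try by move: pP nN.
all: rewrite -?EFinB -?EFinD => _ [e].
all: congr EFin; lra.
Qed.

(** [signed_esum] splits its summand into positive and negative part, which are
    in general smaller than [P i] and [N i] because of cancellation inside each
    term.  Finiteness of one of the two sums makes the excess finite. *)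
Lemma signed_esumB (I : choiceType) (D : set I) (P N : I -> \bar R) :
  (forall i, D i -> 0 <= P i) -> (forall i, D i -> 0 <= N i) ->
  \esum_(i in D) P i < +oo \/ \esum_(i in D) N i < +oo ->
  signed_esum D (fun i => P i - N i) =
  \esum_(i in D) P i - \esum_(i in D) N i.
Proof.
move=> P0 N0 fin.
have le_term (a : I -> \bar R) i :
    (forall i, D i -> 0 <= a i) -> D i -> a i <= \esum_(i in D) a i.
  move=> a0 Di; apply: esum_ge; exists [set i]; last by rewrite fsbig_set1.
  by split => // _ ->.
have bal i : D i -> _ := fun Di => maxe_sub_balance (P0 i Di) (N0 i Di)
  (match fin with
   | or_introl fP => or_introl (le_lt_trans (le_term P i P0 Di) fP)
   | or_intror fN => or_intror (le_lt_trans (le_term N i N0 Di) fN)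
   end).
apply: sube_eq_balance => //.
- apply/andP; split; first by apply: esum_ge0 => i _; exact: funepos_ge0.
  by apply: le_esum => i /bal[pP _ _]; rewrite funeposE.
- apply/andP; split; first by apply: esum_ge0 => i _; exact: funeneg_ge0.
  by apply: le_esum => i /bal[_ nN _]; rewrite funenegE.
- rewrite -!esumD//; try by [move=> i _; exact: funepos_ge0
                            |move=> i _; exact: funeneg_ge0].
  by apply: eq_esum => i /bal[_ _ e]; rewrite funeposE funenegE.
Qed.

(** The form in which the negative subchains cancel: [u] and [v] stand for the
    contributions of the full chain to the positive and negative parts, [a] and
    [b] for those of the negative subchains. *)
Lemma sube_common_cancel (u v a b : \bar R) :
  0 <= u -> 0 <= v -> 0 <= a -> 0 <= b ->
  u + a + b < +oo \/ v + b + a < +oo ->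
  u - v = (u + a) - (v + b) - (a - b).
Proof.
case: u v a b => [u| |] [v| |] [a| |] [b| |] // _ _ _ _ []// _.
all: by rewrite -!(EFinD, EFinB); congr EFin; lra.
Qed.

(** Covering multiplicities mp and mm with mp - mm = 1 are both finite, since
    subtracting an infinite mm gives [-oo]; so mp = 1 + mm, and the identity is
    the sum over k of g k * mp = g k + g k * mm. *)
Lemma esum_signed_cover (I K : choiceType) (Dp Dm : set I) (A : I -> set K)
    (g : K -> R) :
  (forall k, \esum_(i in Dp) (\1_(A i) k)%:E -
             \esum_(i in Dm) (\1_(A i) k)%:E = 1%:E :> \bar R) ->
  (forall k, (0 <= g k)%R) ->
  \esum_(i in Dp) \esum_(k in A i) (g k)%:E =
  \esum_(k in [set: K]) (g k)%:E +
  \esum_(i in Dm) \esum_(k in A i) (g k)%:E.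
Proof.
move=> cover g0; rewrite !esum_exchange_cover//.
have mult0 (D : set I) k : 0 <= \esum_(i in D) (\1_(A i) k)%:E :> \bar R.
  by apply: esum_ge0 => i _; rewrite lee_fin.
rewrite -esumD; [|by move=> k _; rewrite lee_fin
                 |by move=> k _; rewrite mule_ge0 ?lee_fin].
apply: eq_esum => k _.
suff -> : \esum_(i in Dp) (\1_(A i) k)%:E =
          1 + \esum_(i in Dm) (\1_(A i) k)%:E :> \bar R.
  by rewrite ge0_muleDr// mule1.
move: (cover k) (mult0 Dp k) (mult0 Dm k).
case: (esum Dp _) (esum Dm _) => [x| |] [y| |] //= + _ _.
by rewrite -EFinB => -[xy]; congr EFin; lra.
Qed.

End unconditional_sums.

(** Some state [i] carries mass, and at a time [t] when [l] is reachable from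
    [i], invariance gives [pi l] at least [pi i * trans X t i l]. *)
Lemma stationary_gt0 (R : realType) (S : countType) (A : set S)
    (X : ctmc R A) (pi : S -> R) (l : S) :
  irreducible X -> stationary X pi -> A l -> 0 < pi l.
Proof.
move=> Xirr [pi_ge0 pi_sum1 pi_inv] Al.
have [i Ai pii] : exists2 i, A i & 0 < pi i.
  apply: contrapT => no_mass.
  have : (\esum_(k in A) (pi k)%:E = 0)%E.
    apply: esum1 => k Ak; congr EFin; apply/eqP.
    rewrite eq_le pi_ge0// andbT leNgt; apply/negP => pik.
    by apply: no_mass; exists k.
  by rewrite pi_sum1 => /eqP; rewrite onee_eq0.
have [t t0 til] := Xirr i l Ai Al.
rewrite -lte_fin -(pi_inv t l t0 Al).
apply: (@lt_le_trans _ _ ((pi i)%:E * trans X t i l)%E).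
  by rewrite mule_gt0 ?lte_fin.
apply: esum_ge; exists [set i]; last by rewrite fsbig_set1.
by split => // _ ->.
Qed.

Lemma expect_ge0E (R : realType) (S : countType) (A : set S) (pi g : S -> R) :
  (forall k, A k -> 0 <= pi k) -> (forall k, 0 <= g k) ->
  expect A pi g = \esum_(k in A) (g k * pi k)%:E.
Proof.
move=> pi0 g0; rewrite /expect /signed_esum.
rewrite [X in (_ - X)%E]esum1 ?sube0; last first.
  by move=> k Ak; rewrite funenegE max_r// leeNl oppe0 lee_fin mulr_ge0 ?pi0.
by apply: eq_esum => k Ak; rewrite funeposE max_l// lee_fin mulr_ge0 ?pi0.
Qed.

(** As [pi >= 0], the positive and negative parts of [f * pi] are [f^+ * pi] and
    [f^- * pi], so both sides are the same difference, finite or not. *)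
Lemma expect_posneg (R : realType) (S : countType) (A : set S) (pi f : S -> R) :
  (forall k, A k -> 0 <= pi k) ->
  expect A pi f = (expect A pi f^\+%R - expect A pi f^\-%R)%E.
Proof.
move=> pi0; rewrite (expect_ge0E pi0 (funrpos_ge0 f)).
rewrite (expect_ge0E pi0 (funrneg_ge0 f)).
rewrite /expect /signed_esum; congr (_ - _)%E; apply: eq_esum => k Ak.
  by rewrite funeposE -EFin_max /funrpos maxr_pMl ?pi0// mul0r.
by rewrite funenegE -EFinN -EFin_max /funrneg maxr_pMl ?pi0// mul0r mulNr.
Qed.

(** A positive real factor preserves infinities, and with them the value
    [-oo] of [+oo - +oo]. *)
Lemma pos_divB (R : realType) (x y : \bar R) (r : R) :
  0 < r -> ((x - y) / r%:E = x / r%:E - y / r%:E)%E.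
Proof.
move=> r0; rewrite inver gt_eqF//.
case: x y => [x| |] [y| |] //=.
- by rewrite -EFinB -!EFinM -EFinB mulrBl.
all: rewrite ?gt0_mulye ?gt0_mulNye ?lte_fin ?invr_gt0//.
Qed.

(** As [ext_prob pi pij r k = pi k / c], the unknown factor [c] cancels against
    [pi = c * pij]: the ratio depends on the subchain through [A] only. *)
Lemma expect_div_ext_prob (R : realType) (S : countType) (A : set S)
    (pi pij g : S -> R) (c : R) (r k : S) :
  (forall l, 0 < pi l) -> (forall l, A l -> 0 < pij l) ->
  (forall l, A l -> pi l = c * pij l) -> A r -> (forall l, 0 <= g l) ->
  (expect A pij g / (ext_prob pi pij r k)%:E =
   \esum_(l in A) (g l * (pi l / pi k))%:E)%E.
Proof.
move=> pi0 pij0 piE Ar g0.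
have pijr0 : pij r != 0 by rewrite gt_eqF ?pij0.
have c0 : c != 0.
  by apply: contraTneq (pi0 r) => c0; rewrite piE// c0 mul0r ltxx.
have -> : ext_prob pi pij r k = pi k / c.
  by rewrite /ext_prob (piE r)// invfM -!mulrA mulVf// mulr1.
have pik : pi k != 0 by rewrite gt_eqF.
have cE : 0 <= c / pi k.
  have := pi0 r; rewrite piE// pmulr_lgt0 ?pij0// => c_gt0.
  by rewrite divr_ge0// ltW.
rewrite expect_ge0E//; last by move=> l /pij0/ltW.
rewrite inver mulf_eq0 invr_eq0 (negPf c0) (negPf pik)/= muleC -ge0_esumZl.
- apply: eq_esum => l Al; rewrite -EFinM (piE l)// invf_div; congr EFin.
  by rewrite mulrCA mulrA -!mulrA; congr (_ * _); rewrite mulrCA mulrC -mulrA.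
- by rewrite invf_div.
- by move=> l Al; rewrite lee_fin mulr_ge0// ltW ?pij0.
Qed.

Theorem theorem1 (R : realType) (S : countType)
  (X : ctmc R [set: S]) (pi : S -> R)
  (Xerg : ergodic X) (Xstat : stationary X pi)
  (J : choiceType) (Jp Jm : set J)
  (Jp0 : Jp !=set0) (JE : Jp `|` Jm = [set: J])
  (A : J -> set S) (A0 : forall j, A j !=set0)
  (Acover : \bigcup_(j in Jp) A j = [set: S])
  (Asigned : forall k : S,
    (\esum_(j in Jp) (\1_(A j) k)%:E - \esum_(j in Jm) (\1_(A j) k)%:E
     = 1%:E :> \bar R)%E)
  (Y : forall j, ctmc R (A j)) (pij : J -> S -> R)
  (Yerg : forall j, ergodic (Y j))
  (Ystat : forall j, stationary (Y j) (pij j))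
  (Hcons : conservation A pi pij)
  (* the arbitrary k' in A j used to compute pi^j_(k) *)
  (ref : J -> S) (refA : forall j, A j (ref j))
  (f : S -> R) (k : S)
  (Hf : sums_well_defined Jp Jm A pij
          (fun j => ext_prob pi (pij j) (ref j) k) f) :
  (expect [set: S] pi f / (pi k)%:E =
   signed_esum Jp (fun j =>
     expect (A j) (pij j) f / (ext_prob pi (pij j) (ref j) k)%:E) -
   signed_esum Jm (fun j =>
     expect (A j) (pij j) f / (ext_prob pi (pij j) (ref j) k)%:E))%E.
Proof.
have pi_gt0 l : 0 < pi l := stationary_gt0 Xerg.1 Xstat I.
have pij_gt0 j l : A j l -> 0 < pij j l := stationary_gt0 (Yerg j).1 (Ystat j).
set p := fun j => ext_prob pi (pij j) (ref j) k.
have p_gt0 j : 0 < p j.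
  by rewrite /p /ext_prob mulr_gt0 ?divr_gt0 ?pij_gt0.
have ratioE (g : S -> R) j : (forall l, 0 <= g l) ->
    (expect (A j) (pij j) g / (p j)%:E =
     \esum_(l in A j) (g l * (pi l / pi k))%:E)%E.
  move=> g0; have [c piE] := Hcons j.
  by apply: (expect_div_ext_prob (c := c)) => // l; exact: pij_gt0.
(* The full chain is treated as the subchain [setT] with factor 1. *)
have fullE (g : S -> R) : (forall l, 0 <= g l) ->
    (expect [set: S] pi g / (pi k)%:E =
     \esum_(l in [set: S]) (g l * (pi l / pi k))%:E)%E.
  move=> g0; have pik : ext_prob pi pi k k = pi k.
    by rewrite /ext_prob divfK ?gt_eqF.
  rewrite -(@expect_div_ext_prob _ _ _ pi pi g 1 k k)// ?pik// => l _.
  by rewrite mul1r.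
have weight_ge0 (g : S -> R) l : (forall l, 0 <= g l) ->
    0 <= g l * (pi l / pi k).
  by move=> g0; rewrite mulr_ge0// divr_ge0// ltW.
have ratio_ge0 (g : S -> R) j : (forall l, 0 <= g l) ->
    (0 <= expect (A j) (pij j) g / (p j)%:E)%E.
  move=> g0; rewrite ratioE//; apply: esum_ge0 => l _.
  by rewrite lee_fin weight_ge0.
have coverE (g : S -> R) : (forall l, 0 <= g l) ->
    (\esum_(j in Jp) (expect (A j) (pij j) g / (p j)%:E) =
     expect [set: S] pi g / (pi k)%:E +
     \esum_(j in Jm) (expect (A j) (pij j) g / (p j)%:E))%E.
  move=> g0; rewrite fullE//.
  have sumE (D : set J) := eq_esum (fun j (_ : D j) => ratioE g j g0).
  rewrite !sumE.
  by apply: esum_signed_cover => // l; exact: weight_ge0.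
have fp0 := funrpos_ge0 f; have fn0 := funrneg_ge0 f.
have splitE : (fun j => expect (A j) (pij j) f / (p j)%:E)%E =
    (fun j => expect (A j) (pij j) f^\+%R / (p j)%:E -
              expect (A j) (pij j) f^\-%R / (p j)%:E)%E.
  apply/funext => j; rewrite expect_posneg; last by move=> l /pij_gt0/ltW.
  exact: pos_divB.
rewrite splitE expect_posneg; last by move=> l _; exact/ltW.
rewrite pos_divB//.
(* By [coverE], [Hf] bounds the contributions of the full chain as well as
   those of the negative subchains. *)
move: Hf; rewrite /sums_well_defined -/p !coverE// => fin.
have a0 : (0 <= \esum_(j in Jm) (expect (A j) (pij j) f^\+%R / (p j)%:E))%E.
  by apply: esum_ge0 => j _; exact: ratio_ge0.
have b0 : (0 <= \esum_(j in Jm) (expect (A j) (pij j) f^\-%R / (p j)%:E))%E.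
  by apply: esum_ge0 => j _; exact: ratio_ge0.
have U0 : (0 <= expect [set: S] pi f^\+%R / (pi k)%:E)%E.
  by rewrite fullE//; apply: esum_ge0 => l _; rewrite lee_fin weight_ge0.
have V0 : (0 <= expect [set: S] pi f^\-%R / (pi k)%:E)%E.
  by rewrite fullE//; apply: esum_ge0 => l _; rewrite lee_fin weight_ge0.
have lty_summands (x y : \bar R) : (0 <= x)%E -> (0 <= y)%E ->
    (x + y < +oo -> x < +oo /\ y < +oo)%E.
  by move=> x0 y0 xy; split; apply: le_lt_trans xy; [exact: leeDl|exact: leeDr].
rewrite !signed_esumB ?coverE//; try by move=> j _; exact: ratio_ge0.
- exact: sube_common_cancel.
- by case: fin => /lty_summands[]; rewrite ?adde_ge0//; [right|left].
- by case: fin => /lty_summands[]; rewrite ?adde_ge0//; [left|right].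
Qed.
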